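(* The space $\big(\Sigma'/\Lambda(\Sigma)\big)/{\sim}$ is spanned by states of the form $|\chi_i(\mathbf s)\rangle$; that is, every $|s\rangle\in\Sigma'$ is equivalent (under $\sim$) to the sum of a symmetric state (an element of $\Lambda(\Sigma)$) and a linear combination of states $|\chi_i(\mathbf s)\rangle$, where $|\mathbf s\rangle$ ranges over the canonical basis states of $\Sigma$ and $i$ over the indices of the distinct components of $\mathbf s$.
   Context: $N\ge3$ is an integer. For a fixed $M\in\frac12\mathbb N$, $\Sigma$ is the complex vector space with canonical basis $|\mathbf s\rangle=|s_1\dots s_N\rangle$, $s_i\in\{-M,-M+1,\dots,M\}$. $S_N$ acts on $\Sigma$ by permuting spin components ($\pi$ moves the component in position $k$ to position $\pi(k)$); $S_{ij}$ is the transposition of spins $i,j$. $\Lambda$ is the projector onto states totally symmetric under simultaneous permutations of coordinates $z_1,\dots,z_N$ and spins (average over $S_N$); on $\Sigma$, $\Lambda=\frac1{N!}\sum_{\pi}\pi$. For $|s\rangle\in\Sigma$ and $i\ne j$ put $|s^+_{ij}\rangle=\frac1{N!}\sum_{\pi\in S_N,\,\pi(1)=i,\,\pi(2)=j}\pi(1+S_{12})|s\rangle$, and $\Sigma'=\{|s\rangle\in\Sigma:\sum_{i=1}^N|s^+_{i,i+1}\rangle\in\Lambda(\Sigma)\}$ (indices cyclic, $N+1\equiv1$). Equivalence: $|s\rangle\sim|\tilde s\rangle$ iff $\Lambda(z_1z_2|s\rangle)=\Lambda(z_1z_2|\tilde s\rangle)$. For a basis state $|\mathbf s\rangle$ let $s^1,\dots,s^n$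 be the distinct components of $\mathbf s$ and $\nu_i$ the number of times $s^i$ occurs in $\mathbf s$. For $i=1,\dots,n$ define (up to equivalence) $|\chi_i\rangle\equiv|\chi_i(\mathbf s)\rangle$ by $$|\chi_i\rangle=\nu_i(\nu_i-1)|s^is^i\dots\rangle-\sum_{1\le j,k\le n;\ j,k\ne i}\nu_j(\nu_k-\delta_{jk})|s^js^k\dots\rangle\quad\text{if }\nu_i>1,$$ $$|\chi_i\rangle=\sum_{1\le j\le n,\ j\ne i}\nu_j\big(|s^is^j\dots\rangle+|s^js^i\dots\rangle\big)\quad\text{if }\nu_i=1,$$ where an ellipsis inside a ket stands for an arbitrary ordering of the remaining components of $\mathbf s$ (so each ket is a permutation of $|\mathbf s\rangle$ with the first two entries as shown), and terms with zero coefficient are omitted. *)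

(* Defs.v *)
From HB Require Import structures.
From mathcomp Require Import all_boot all_order all_algebra all_fingroup.
From mathcomp Require Export complex reals.
From mathcomp Require Export mpoly.

Set Implicit Arguments.
Unset Strict Implicit.
Unset Printing Implicit Defensive.

Import Order.TTheory GRing.Theory Num.Theory.
Local Open Scope ring_scope.

(* The spin M is given by twoM = 2M, so that M ranges over the half-integers.
   The index k : 'I_twoM.+1 stands for the spin component k - M; only the
   distinctness of the components matters in what follows.                  *)
Notation spin twoM := 'I_twoM.+1 (only parsing).

(* Basis labels s = (s_1, ..., s_N); sites are numbered from 0 to N - 1. *)
Notation config N twoM := {ffun 'I_N -> 'I_twoM.+1} (only parsing).

(* The space Sigma: a state is the family of its coordinates in the canonical
   basis.                                                                   *)
Notation state K N twoM :=
  {ffun {ffun 'I_N -> 'I_twoM.+1} -> K^o} (only parsing).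

(* Sigma-valued polynomials in the coordinates z_1, ..., z_N. *)
Notation wave K N twoM :=
  {ffun {ffun 'I_N -> 'I_twoM.+1} -> {mpoly K[N]}} (only parsing).

Section Defs.

Variables (K : numFieldType) (N twoM : nat).

Implicit Types (s t : config N twoM) (v w : state K N twoM)
  (Psi : wave K N twoM) (p : {mpoly K[N]}) (pi : 'S_N) (a b c : spin twoM).

Definition ket s : state K N twoM := [ffun t => (t == s)%:R].

(* The component in position k is moved to position pi k. *)
Definition perm_config pi s : config N twoM := [ffun k => s ((pi^-1)%g k)].

Definition perm_state pi v : state K N twoM :=
  \sum_s v s *: ket (perm_config pi s).

Definition pure_wave p v : wave K N twoM := [ffun s => v s *: p].

(* Simultaneous permutation of coordinates (z_k becomes z_(pi k)) and spins. *)
Definition perm_wave pi Psi : wave K N twoM :=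
  \sum_s pure_wave (msym pi (Psi s)) (ket (perm_config pi s)).

Definition Lambda v : state K N twoM :=
  (N`!%:R : K)^-1 *: \sum_(pi : 'S_N) perm_state pi v.

Definition Lambda_wave Psi : wave K N twoM :=
  (N`!%:R : K)^-1 *: \sum_(pi : 'S_N) perm_wave pi Psi.

Definition symmetric_state v : Prop := exists w, v = Lambda w.

Hypothesis hN : (2 < N)%N.

Definition site1 : 'I_N := Ordinal (ltnW (ltnW hN)).
Definition site2 : 'I_N := Ordinal (ltnW hN).

Definition plus_state (i j : 'I_N) v : state K N twoM :=
  (N`!%:R : K)^-1 *:
    \sum_(pi : 'S_N | (pi site1 == i) && (pi site2 == j))
      perm_state pi (v + perm_state (tperm site1 site2) v).

(* The space Sigma'; ordS is the cyclic successor on 'I_N. *)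
Definition in_Sigma' v : Prop :=
  symmetric_state (\sum_(i < N) plus_state i (ordS i) v).

Definition equiv_state v w : Prop :=
  Lambda_wave (pure_wave ('X_site1 * 'X_site2) v)
  = Lambda_wave (pure_wave ('X_site1 * 'X_site2) w).

Definition mult s a : nat := #|[set k | s k == a]|.

(* t = s^b s^c ... : a reordering of s whose first two entries are b and c. *)
Definition arrangement s b c t : Prop :=
  [/\ exists pi, t = perm_config pi s, t site1 = b & t site2 = c].

(* The states chi_i(s), indexed by the distinct component a = s^i of s; the
   function arr supplies the ket |b c ...> for each pair (b, c).             *)
Definition chi (arr : spin twoM -> spin twoM -> config N twoM) s a :
    state K N twoM :=
  if (1 < mult s a)%N then
    (mult s a * (mult s a - 1))%:R *: ket (arr a a)
    - \sum_(b in codom s | b != a) \sum_(c in codom s | c != a)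
        (mult s b * (mult s c - (b == c)))%:R *: ket (arr b c)
  else
    \sum_(b in codom s | b != a)
      (mult s b)%:R *: (ket (arr a b) + ket (arr b a)).

(* chi_i(s) depends on the arbitrary orderings hidden in the ellipses, so it is
   rendered as the predicate "v is chi_i(s) for some choice of orderings".  The
   function arr is constrained only where b and c occur at two different sites
   of s; elsewhere the corresponding coefficient vanishes.                   *)
Definition is_chi s a v : Prop :=
  exists arr : spin twoM -> spin twoM -> config N twoM,
    (forall b c, (0 < mult s b * (mult s c - (b == c)))%N ->
       arrangement s b c (arr b c))
    /\ v = chi arr s a.

Lemma is_chi_exists s a : exists v, is_chi s a v.
Proof.
pose P b c t := [&& [exists pi, t == perm_config pi s], t site1 == b & t site2 == c].
pose arr b c := odflt s [pick t | P b c t].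
exists (chi arr s a), arr; split=> // b c.
rewrite muln_gt0 subn_gt0 => /andP[/card_gt0P[k]]; rewrite inE => /eqP sk lt_c.
have [l sl Dl] : exists2 l, s l = c & l != k.
  have : (0 < #|[set l | s l == c] :\ k|)%N.
    rewrite -(ltn_add2l (k \in [set l | s l == c])) -cardsD1 inE sk addn0.
    exact: lt_c.
  by case/card_gt0P=> l; rewrite !inE => /andP[Dl /eqP sl]; exists l.
suff [t Pt] : exists t, P b c t.
  rewrite /arr; case: pickP => [u|/(_ t)]; last by rewrite Pt.
  by case/and3P=> /existsP[pi /eqP Du] /eqP u1 /eqP u2; split=> //; exists pi.
pose q := tperm k site1 l.
have Dq : q != site1 by rewrite -(tpermL k site1) (inj_eq perm_inj).
pose pi := (tperm k site1 * tperm q site2)%g.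
have pik : pi k = site1 by rewrite permM tpermL tpermD // eq_sym.
have pil : pi l = site2 by rewrite permM tpermL.
exists (perm_config pi s); apply/and3P; split; first by apply/existsP; exists pi.
- by rewrite ffunE -pik permK sk.
- by rewrite ffunE -pil permK sl.
Qed.

End Defs.

(* Main.v *)
(* Fix a basis label t and view P(i, j) = <t| s^+_(ij)> as a function on pairs of
   distinct sites; relabelling t by rho turns P(i, j) into P(rho i, rho j), and
   |s> ~ |s'> as soon as their functions P agree for all t.  Membership in Sigma'
   says that the sum of P(rho i, rho (i + 1)) over i does not depend on rho.
   Comparing rho with rho composed with the swap of two neighbours gives
   P(p, x) + P(y, q) = P(p, y) + P(x, q) on distinct sites, i.e.
   P(i, j) = h(i) + h(j), and h(i) depends only on t_i because P is invariant
   under the stabilizer of t.  For chi_a(s) a count of permutations gives, on the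
   orbit of s, h(i) = [t_i = a] up to a factor and an additive constant; so the
   chi_a(s) produce every h up to constants, which are produced by symmetric
   states. *)

Require Import Defs.
From HB Require Import structures.
From mathcomp Require Import all_boot all_order all_algebra all_fingroup.
From mathcomp Require Import complex reals.
From mathcomp Require Import ring.

Set Implicit Arguments.
Unset Strict Implicit.
Unset Printing Implicit Defensive.

Import Order.TTheory GRing.Theory Num.Theory.
Local Open Scope ring_scope.

(** * Prescribed permutations and pair functions of the form h(i) + h(j) *)

Lemma exists_perm_map (T : finType) (s t : seq T) :
  uniq s -> uniq t -> size s = size t -> exists rho : {perm T}, map rho s = t.
Proof.
elim: s t => [|x s IHs] [|y t] //=; first by exists 1%g.
case/andP=> xs us /andP[yt ut] [/(IHs _ us ut)[rho Dt]].
exists (rho * tperm (rho x) y)%g; rewrite permM tpermL -Dt; congr (_ :: _).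
apply/eq_in_map=> z zs; rewrite permM tpermD //.
  by rewrite (inj_eq perm_inj); apply: contraNneq xs => ->.
by apply: contraNneq yt => ->; rewrite -Dt map_f.
Qed.

Lemma exists_ordS_uniq4 (N : nat) : (3 < N)%N ->
  exists e0 e1 e2 e3 : 'I_N,
    [/\ ordS e0 = e1, ordS e1 = e2, ordS e2 = e3 & uniq [:: e0; e1; e2; e3]].
Proof.
move=> lt3N; have lt2N := ltnW lt3N; have lt1N := ltnW lt2N.
exists (Ordinal (ltnW lt1N)), (Ordinal lt1N), (Ordinal lt2N), (Ordinal lt3N).
by split=> //; apply: val_inj; rewrite /= modn_small.
Qed.

(** The triangle [a], [b], [c] determines h at [a], and [P a i] then forces h at every other site.
    The four-point identity makes the pairs avoiding [a] agree; for N = 3 the triangle equations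
    alone suffice. *)
Lemma additive_on_pairs (K : numFieldType) (N : nat) (P : 'I_N -> 'I_N -> K) :
    (2 < N)%N -> (forall i j, P i j = P j i) ->
    (forall p x y q, uniq [:: p; x; y; q] ->
       P p x + P y q = P p y + P x q) ->
  exists h : 'I_N -> K, forall i j, i != j -> P i j = h i + h j.
Proof.
move=> hN symP fourP.
pose a := Ordinal (ltnW (ltnW hN)); pose b := Ordinal (ltnW hN).
pose c := Ordinal hN.
pose ha := (P a b + P a c - P b c) / 2.
have ha2 : ha + ha = P a b + P a c - P b c by rewrite -splitr.
pose h i := if i == a then ha else P a i - ha.
have ha_eq i : i != a -> i != b -> ha + ha = P a b + P a i - P b i.
  rewrite ha2 => ia ib; have [->//|ic] := eqVneq i c.
  have := fourP i b a c; rewrite /= !inE !negb_or ia ib ic => /(_ isT).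
  by rewrite (symP i) (symP i) => /(canRL (addKr _)) ->; ring.
have off i j : i != a -> j != a -> i != j -> P i j = P a i + P a j - (ha + ha).
  move=> ia ja ij; have [Di|ib] := eqVneq i b.
    have jb : j != b by rewrite -Di eq_sym.
    by rewrite (ha_eq j) // Di; ring.
  have [Dj|jb] := eqVneq j b.
    by rewrite (ha_eq i) // Dj (symP i); ring.
  have := fourP j i a b; rewrite /= !inE !negb_or ia ja ib jb eq_sym ij.
  move/(_ isT).
  by rewrite (ha_eq i) // (symP j) (symP j) (symP i b) =>
    /(canRL (addrK _)) ->; ring.
exists h => i j ij; rewrite /h.
have [Di|ia] := eqVneq i a; have [Dj|ja] := eqVneq j a.
- by rewrite Di Dj eqxx in ij.
- by rewrite Di addrC subrK.
- by rewrite Dj symP subrK.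
- by rewrite off // opprD addrACA.
Qed.

(** * Relabelled configurations and invariant states *)

Section Relabel.

Variables (K : numFieldType) (N twoM : nat).
Implicit Types (s t u : config N twoM) (v w : state K N twoM).
Implicit Types (pi rho : 'S_N) (i j : 'I_N).

(** The inverse of the action [perm_config]; it appears when a permuted state is read off in
    coordinates. *)
Definition relabel t pi : config N twoM := [ffun k => t (pi k)].

Lemma relabelM t pi rho : relabel (relabel t rho) pi = relabel t (pi * rho).
Proof. by apply/ffunP=> k; rewrite !ffunE permM. Qed.

Lemma relabel1 t : relabel t 1 = t.
Proof. by apply/ffunP=> k; rewrite !ffunE perm1. Qed.

Lemma relabelK t rho : relabel (relabel t rho) rho^-1 = t.
Proof. by rewrite relabelM mulVg relabel1. Qed.

Lemma relabelKV t rho : relabel (relabel t rho^-1) rho = t.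
Proof. by rewrite relabelM mulgV relabel1. Qed.

Lemma perm_configE pi t : perm_config pi t = relabel t pi^-1.
Proof. by []. Qed.

Lemma eq_perm_config pi s t : (t == perm_config pi s) = (s == relabel t pi).
Proof.
rewrite perm_configE; apply/eqP/eqP => ->; first by rewrite relabelKV.
by rewrite relabelK.
Qed.

Lemma perm_stateE pi v t : perm_state pi v t = v (relabel t pi).
Proof.
rewrite /perm_state sum_ffunE (bigD1 (relabel t pi)) //= big1 ?addr0 => [|s].
  by rewrite !ffunE eq_perm_config eqxx /= /GRing.scale /= mulr1.
rewrite !ffunE eq_perm_config => /negPf->; exact: mulr0.
Qed.

Lemma LambdaE v t :
  Lambda v t = N`!%:R^-1 * \sum_pi v (relabel t pi) :> K.
Proof.
rewrite ffunE sum_ffunE; congr (_ * _).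
by apply: eq_bigr => pi _; rewrite perm_stateE.
Qed.

Lemma symmetric_stateP v :
  symmetric_state v <-> forall t pi, v (relabel t pi) = v t.
Proof.
split=> [[w ->] t rho | inv_v].
  rewrite !LambdaE [in RHS](reindex_inj (mulIg rho)).
  by congr (_ * _); apply: eq_bigr => pi _; rewrite relabelM.
(* An invariant [v] is its own average. *)
exists v; apply/ffunP=> t; rewrite LambdaE (eq_bigr _ (fun pi _ => inv_v t pi)).
rewrite sumr_const (eq_card (B := [set: 'S_N])) => [|pi]; last by rewrite inE.
rewrite cardsT card_Sn -[v t *+ _](@mulr_natl K); symmetry; apply: (@mulKf K).
by rewrite pnatr_eq0 -lt0n fact_gt0.
Qed.

End Relabel.

(** * Sums over permutations with two prescribed values; description of Sigma' *)

Section PairSums.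

Variables (K : numFieldType) (N twoM : nat) (hN : (2 < N)%N).
Implicit Types (s t u : config N twoM) (v w : state K N twoM).
Implicit Types (pi rho : 'S_N) (i j : 'I_N) (a b c : spin twoM).

Local Notation p1 := (site1 hN).
Local Notation p2 := (site2 hN).

(** Up to 1/N!, the contribution of the ordered pair (i, j) to the coefficient of z_i z_j in
    Lambda(z_1 z_2 |v>) at [t]; adding both orders gives P(i, j). *)
Definition pair_sum i j t v : K :=
  \sum_(pi : 'S_N | (pi p1 == i) && (pi p2 == j)) v (relabel t pi).

Lemma pair_sum_is_scalar i j t : scalar (pair_sum i j t).
Proof.
move=> k v w; rewrite /pair_sum mulr_sumr -big_split /=.
by apply: eq_bigr => pi _; rewrite !ffunE.
Qed.
HB.instance Definition _ i j t := GRing.isLinear.Build K (state K N twoM) K _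
  (pair_sum i j t) (pair_sum_is_scalar i j t).

Lemma pair_sumD i j t v w :
  pair_sum i j t (v + w) = pair_sum i j t v + pair_sum i j t w.
Proof. exact: raddfD. Qed.

Lemma pair_sumB i j t v w :
  pair_sum i j t (v - w) = pair_sum i j t v - pair_sum i j t w.
Proof. exact: raddfB. Qed.

Lemma pair_sumZ i j t k v : pair_sum i j t (k *: v) = k * pair_sum i j t v.
Proof. exact: linearZ. Qed.

Lemma pair_sum_sum i j t I (r : seq I) (P : pred I) (F : I -> state K N twoM) :
  pair_sum i j t (\sum_(k <- r | P k) F k)
  = \sum_(k <- r | P k) pair_sum i j t (F k).
Proof. exact: raddf_sum. Qed.

Lemma pair_sum_diag i v t : pair_sum i i t v = 0.
Proof.
by apply: big_pred0 => pi; apply/andP=> -[/eqP <-]; rewrite (inj_eq perm_inj).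
Qed.

Lemma plus_stateE i j v t :
  plus_state hN i j v t
  = N`!%:R^-1 * (pair_sum i j t v + pair_sum j i t v) :> K.
Proof.
rewrite ffunE sum_ffunE; congr (_ * _).
transitivity (\sum_(pi : 'S_N | (pi p1 == i) && (pi p2 == j))
   (v (relabel t pi) + v (relabel t (tperm p1 p2 * pi)))).
  by apply: eq_bigr => pi _; rewrite perm_stateE ffunE perm_stateE relabelM.
rewrite big_split; congr (_ + _).
rewrite [RHS](reindex_inj (mulgI (tperm p1 p2))); apply: eq_bigl => pi.
by rewrite !permM tpermL tpermR andbC.
Qed.

Lemma plus_stateC i j v t : plus_state hN i j v t = plus_state hN j i v t.
Proof. by rewrite !plus_stateE addrC. Qed.

Lemma pair_sum_relabel i j v t rho :
  pair_sum i j (relabel t rho) v = pair_sum (rho i) (rho j) t v.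
Proof.
rewrite [RHS](reindex_inj (mulIg rho)); apply: eq_big => [pi|pi _].
  by rewrite !permM !(inj_eq perm_inj).
by rewrite relabelM.
Qed.

Lemma plus_state_relabel i j v t rho :
  plus_state hN i j v (relabel t rho) = plus_state hN (rho i) (rho j) v t.
Proof. by rewrite !plus_stateE !pair_sum_relabel. Qed.

Lemma sum_pair_sum v t :
  \sum_i \sum_j pair_sum i j t v = \sum_pi v (relabel t pi).
Proof.
by rewrite pair_big (partition_big (fun pi : 'S_N => (pi p1, pi p2)) xpredT).
Qed.

(** A closed cycle meets each site twice, so an additive P has the same sum for every relabelling.
    Conversely, swapping two neighbours on the cycle isolates the identity required by
    [additive_on_pairs]. *)
Lemma in_Sigma'P v :
  in_Sigma' hN v <->
  forall t, exists h : 'I_N -> K,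
    forall i j, i != j -> plus_state hN i j v t = h i + h j.
Proof.
have -> : in_Sigma' hN v <-> forall t rho,
    \sum_i plus_state hN (rho i) (rho (ordS i)) v t
      = \sum_i plus_state hN i (ordS i) v t.
  rewrite /in_Sigma' symmetric_stateP; split=> inv_v t rho.
    have:= inv_v t rho; rewrite !sum_ffunE => <-.
    by apply: eq_bigr => i _; rewrite plus_state_relabel.
  rewrite !sum_ffunE -[RHS](inv_v t rho).
  by apply: eq_bigr => i _; rewrite plus_state_relabel.
have Sneq i : i != ordS i.
  rewrite -val_eqE /=; have := ltn_ord i.
  rewrite leq_eqVlt => /predU1P[iN|ltiN]; last by rewrite modn_small // ltn_eqF.
  by rewrite iN modnn; apply: contraTneq hN => i0; rewrite -iN i0.
split=> [inv_v t | addv t rho]; last first.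
  have [h Dh] := addv t.
  pose F rho' := \sum_i plus_state hN (rho' i) (rho' (ordS i)) v t.
  have FE rho' : F rho' = \sum_i h i + \sum_i h i.
    transitivity (\sum_i (h (rho' i) + h (rho' (ordS i)))).
      by apply: eq_bigr => i _; rewrite Dh // (inj_eq perm_inj).
    rewrite big_split; congr (_ + _);
      rewrite [RHS](reindex_inj (@perm_inj _ rho')) //.
    by rewrite [RHS](reindex_inj (@ordS_inj N)).
  transitivity (F rho) => //; rewrite FE -(FE 1%g).
  by apply: eq_bigr => i _; rewrite !perm1.
apply: additive_on_pairs => // [i j|p x y q Uq]; first exact: plus_stateC.
have N4 : (3 < N)%N.
  by have := max_card (mem [:: p; x; y; q]); rewrite (card_uniqP Uq) card_ord.
(* [rho] places p, x, y, q at four consecutive positions of the cycle. *)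
have [e0 [e1 [e2 [e3 [De1 De2 De3 Ue]]]]] := exists_ordS_uniq4 N4.
have [rho [Dp Dx Dy Dq]] := exists_perm_map Ue Uq erefl.
have [[e01 e02 e03] [e12 e13 e23]] : [/\ e0 != e1, e0 != e2 & e0 != e3] /\
    [/\ e1 != e2, e1 != e3 & e2 != e3].
  move: Ue; rewrite /= !inE !negb_or.
  by case/and4P=> /and3P[-> -> ->] /andP[-> ->] -> _.
pose F (rho' : 'S_N) i := plus_state hN (rho' i) (rho' (ordS i)) v t.
have splitF rho' : \sum_i F rho' i = F rho' e0 + (F rho' e1 + (F rho' e2 +
    \sum_(i | (i != e0) && (i != e1) && (i != e2)) F rho' i)).
  rewrite (bigD1 e0) // (bigD1 e1) ?(eq_sym e1) // (bigD1 e2) //.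
  by rewrite eq_sym e02 eq_sym.
(* The swap affects only the edges starting at [e0], [e1], [e2]; the middle one is merely reversed,
   so it cancels by symmetry of P. *)
have : \sum_i F (tperm e1 e2 * rho)%g i = \sum_i F rho i by rewrite /F !inv_v.
rewrite !splitF (eq_bigr (F rho)) => [|i /andP[/andP[i0 i1] i2]]; last first.
  rewrite /F !permM !tpermD // 1?eq_sym //.
    by rewrite -De1 (inj_eq (@ordS_inj N)).
  by rewrite -De2 (inj_eq (@ordS_inj N)).
rewrite /F De1 De2 De3 !permM tpermL tpermR !tpermD // 1?eq_sym //.
rewrite Dp Dx Dy Dq (plus_stateC y x) addrCA [RHS]addrCA => /addrI.
by rewrite !addrA => /addIr; rewrite addrC.
Qed.

End PairSums.

(** * Equivalence of states read off from the pair values *)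

Section Equiv.
Variables (K : numFieldType) (N twoM : nat) (hN : (2 < N)%N).
Implicit Types (s t u : config N twoM) (v w : state K N twoM).
Implicit Types (pi rho : 'S_N) (i j : 'I_N) (a b c : spin twoM).

Local Notation p1 := (site1 hN).
Local Notation p2 := (site2 hN).

Lemma Lambda_pure_waveE v t :
  Lambda_wave (pure_wave ('X_p1 * 'X_p2) v) t =
  (N`!%:R^-1 : K) *: \sum_i \sum_j pair_sum hN i j t v *: ('X_i * 'X_j).
Proof.
have msymU pi k : msym pi 'X_k = 'X_(pi k) :> {mpoly K[N]}.
  rewrite msymX; congr 'X_[_]; apply/mnmP=> l; rewrite mnmE !mnm1E.
  by rewrite -(inj_eq (@perm_inj _ pi)) permKV.
rewrite ffunE sum_ffunE; congr (_ *: _).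
transitivity (\sum_(pi : 'S_N)
    v (relabel t pi) *: ('X_(pi p1) * 'X_(pi p2) : {mpoly K[N]})).
  apply: eq_bigr => pi _; rewrite /perm_wave sum_ffunE (bigD1 (relabel t pi)) //=.
  rewrite big1 ?addr0 => [|s]; rewrite !ffunE eq_perm_config ?eqxx.
    by rewrite scale1r msymZ msymM !msymU.
  by move/negPf->; rewrite scale0r.
rewrite pair_big (partition_big (fun pi : 'S_N => (pi p1, pi p2)) xpredT) //=.
apply: eq_bigr => -[i j] _; rewrite /pair_sum scaler_suml /=.
by apply: eq_big => [pi|pi]; rewrite xpair_eqE // => /andP[/eqP-> /eqP->].
Qed.

(** Since z_i z_j = z_j z_i, doubling the double sum brings the two orders of each pair together,
    and 2 is invertible. *)
Lemma equiv_state_of_plus_state v w :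
    (forall t i j, i != j -> plus_state hN i j v t = plus_state hN i j w t) ->
  equiv_state hN v w.
Proof.
move=> eq_vw; apply/ffunP=> t.
pose S x : {mpoly K[N]} := \sum_i \sum_j pair_sum hN i j t x *: ('X_i * 'X_j).
have S2 x : S x + S x = N`!%:R *:
    \sum_i \sum_j (plus_state hN i j x t : K) *: ('X_i * 'X_j).
  rewrite {2}/S exchange_big -big_split scaler_sumr; apply: eq_bigr => i _ /=.
  rewrite -big_split scaler_sumr; apply: eq_bigr => j _ /=.
  rewrite [in X in _ + X]mulrC -scalerDl plus_stateE scalerA mulVKf //.
  by rewrite pnatr_eq0 -lt0n fact_gt0.
rewrite !Lambda_pure_waveE; congr (_ *: _); rewrite -/(S v) -/(S w).
have n2 : (2 : K) != 0 by rewrite pnatr_eq0.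
apply: (can_inj (scalerK n2)); rewrite !scaler_nat !mulr2n !S2; congr (_ *: _).
apply: eq_bigr => i _; apply: eq_bigr => j _; congr (_ *: _).
have [->|ij] := eqVneq i j; last exact: eq_vw.
by rewrite !plus_stateE !pair_sum_diag.
Qed.

End Equiv.

(** * Pair values of the states chi *)

Section Chi.

Variables (K : numFieldType) (N twoM : nat) (hN : (2 < N)%N).
Implicit Types (s t u : config N twoM) (v w : state K N twoM).
Implicit Types (pi rho : 'S_N) (i j : 'I_N) (a b c : spin twoM).

(** Two transpositions suffice: [i] with [i'], then the image of [j] with [j']. Each exchanges sites
    of equal spin and so fixes [s]. *)
Lemma exists_stab_pair s i j i' j' :
    i != j -> i' != j' -> s i = s i' -> s j = s j' ->
  exists rho, [/\ relabel s rho = s, rho i = i' & rho j = j'].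
Proof.
move=> ij ij' si sj.
have tpermP k k' : s k = s k' -> relabel s (tperm k k') = s.
  by move=> sk; apply/ffunP=> l; rewrite ffunE; case: tpermP => // ->.
pose q := tperm i i' j.
have sq : s q = s j by rewrite -{2}(tpermP _ _ si) ffunE.
have qi' : q != i' by rewrite -(tpermL i i') (inj_eq perm_inj) eq_sym.
exists (tperm i i' * tperm q j')%g; rewrite !permM tpermL -/q tpermL.
rewrite (tpermD qi') 1?eq_sym //; split=> //.
by rewrite -relabelM tpermP ?sq // tpermP.
Qed.

Definition stab_card s := #|[set pi : 'S_N | relabel s pi == s]|.

Lemma stab_card_gt0 s : (0 < stab_card s)%N.
Proof. by apply/card_gt0P; exists 1%g; rewrite inE relabel1. Qed.

Lemma sum_ket_relabel s rho :
  \sum_pi ket K (relabel s rho) (relabel s pi) = (stab_card s)%:R :> K.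
Proof.
rewrite (reindex_inj (mulgI rho)) /stab_card -sum1_card natr_sum [RHS]big_mkcond /=.
apply: eq_bigr => pi _; rewrite ffunE -relabelM inE.
have -> : (relabel (relabel s pi) rho == relabel s rho) = (relabel s pi == s).
  by apply/eqP/eqP => [E|->//]; rewrite -[LHS](relabelK _ rho) E relabelK.
by case: eqP.
Qed.

(** Once a site [i] carrying [b] is chosen, the excluded choice j = i would carry [c] exactly when b
    = c; hence the correction term. *)
Lemma mult_pairs s b c :
  (mult s b * (mult s c - (b == c)))%N =
  (\sum_(i | s i == b) \sum_(j | (s j == c) && (j != i)) 1)%N.
Proof.
rewrite /mult -sum1_card big_distrl /=; apply: eq_big => [i|i].
  by rewrite inE.
rewrite inE mul1n => /eqP si; rewrite -sum1_card (bigID (pred1 i)) /=.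
rewrite [X in (X + _)%N](_ : _ = (b == c) :> nat) ?addKn; last first.
  rewrite (eq_bigl (fun j => (j == i) && (b == c))) => [|j]; last first.
    by rewrite inE andbC; case: eqP => // ->; rewrite si.
  case: (b == c); last by rewrite big_pred0 // => j; rewrite andbF.
  by rewrite (eq_bigl (pred1 i)) ?big_pred1_eq // => j; rewrite andbT.
by apply: eq_bigl => j; rewrite inE.
Qed.

Lemma mult_pairs_gt0 s i j : i != j ->
  (0 < mult s (s i) * (mult s (s j) - (s i == s j)))%N.
Proof.
move=> ij; rewrite mult_pairs (bigD1 i) //= (bigD1 j) ?eqxx 1?eq_sym //=.
Qed.

(** Double counting: the pair sums over all pairs of sites add up to the stabilizer order. Only
    pairs carrying (b, c) contribute, equally because the stabilizer is transitive on them, and the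
    coefficient on the left is their number. *)
Lemma pair_sum_ket s u b c i j : i != j ->
    ((0 < mult s b * (mult s c - (b == c)))%N -> arrangement hN s b c u) ->
  (mult s b * (mult s c - (b == c)))%:R * pair_sum hN i j s (ket K u)
  = (stab_card s)%:R *+ ((s i == b) && (s j == c)).
Proof.
(* With a zero coefficient nothing is known of [u], but then no two distinct sites carry [b] and
   [c]. *)
move=> ij; have [w0 _|_ /(_ isT)] := posnP.
  rewrite w0 mul0r; case: andP => // -[/eqP sb /eqP sc].
  by have := mult_pairs_gt0 s ij; rewrite sb sc w0.
case=> -[pi0 Du] ub uc.
have vanish i' j' : ~~ ((s i' == b) && (s j' == c)) ->
    pair_sum hN i' j' s (ket K u) = 0.
  move=> n_bc; apply: big1 => pi /andP[/eqP Di /eqP Dj]; rewrite ffunE.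
  case: eqP => // Du'; case/negP: n_bc.
  by rewrite -Di -Dj -ub -uc -Du' !ffunE !eqxx.
case: (boolP (_ && _)) => [/andP[/eqP sb /eqP sc]|/vanish->]; last exact: mulr0.
rewrite mulr1n -(sum_ket_relabel s pi0^-1) -perm_configE -Du -(sum_pair_sum hN).
rewrite mult_pairs natr_sum mulr_suml big_mkcond; apply: eq_bigr => i' _ /=.
case: ifP => [/eqP sb'|sb']; last first.
  by rewrite big1 // => j' _; rewrite vanish ?sb'.
rewrite natr_sum mulr_suml big_mkcond; apply: eq_bigr => j' _ /=.
case: ifP => [/andP[/eqP sc' ij']|/negbT]; last first.
  rewrite negb_and negbK => /orP[sc'|/eqP->]; last by rewrite pair_sum_diag.
  by rewrite vanish // negb_and sc' orbT.
rewrite eq_sym in ij'.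
have [rho [Ds <- <-]] : exists rho, [/\ relabel s rho = s, rho i = i' & rho j = j'].
  by apply: exists_stab_pair; rewrite ?sb ?sc.
by rewrite mul1r -pair_sum_relabel Ds.
Qed.

Definition pair_ket (arr : spin twoM -> spin twoM -> config N twoM) s b c :
    state K N twoM :=
  (mult s b * (mult s c - (b == c)))%:R *: ket K (arr b c).

Lemma mult_gt0 s a : a \in codom s -> (0 < mult s a)%N.
Proof. by case/codomP=> i ->; apply/card_gt0P; exists i; rewrite inE. Qed.

(** If [a] occurs once, the coefficients for (a, b) and (b, a) with b != a are both [mult s b], so
    both cases of [chi] become sums of [pair_ket]. *)
Lemma chiE arr s a : a \in codom s ->
  chi K arr s a =
    if (1 < mult s a)%N then
      pair_ket arr s a a
      - \sum_(b in codom s | b != a) \sum_(c in codom s | c != a) pair_ket arr s b c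
    else \sum_(b in codom s | b != a) (pair_ket arr s a b + pair_ket arr s b a).
Proof.
move=> /mult_gt0 a_gt0; rewrite /chi; case: ifPn => [_|].
  by rewrite /pair_ket eqxx.
rewrite -leqNgt => a_le1; have {a_gt0 a_le1} a1 : mult s a = 1%N.
  by apply/eqP; rewrite eqn_leq a_le1.
apply: eq_bigr => b /andP[_ /negPf ba].
by rewrite /pair_ket a1 (eq_sym a) ba !subn0 mul1n muln1 scalerDr.
Qed.

Lemma pair_sum_pair_ket arr s b c i j :
    (forall b' c', (0 < mult s b' * (mult s c' - (b' == c')))%N ->
       arrangement hN s b' c' (arr b' c')) -> i != j ->
  pair_sum hN i j s (pair_ket arr s b c)
  = (stab_card s)%:R * ((s i == b)%:R * (s j == c)%:R).
Proof.
move=> Harr ij; rewrite pair_sumZ pair_sum_ket //; last exact: Harr.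
by rewrite -natrM mulnb mulr_natr.
Qed.

Lemma sum_codom_neq s a i :
  \sum_(b in codom s | b != a) (s i == b)%:R = (s i != a)%:R :> K.
Proof.
have [<-|sa] := eqVneq (s i) a.
  by apply: big1 => b /andP[_]; rewrite eq_sym => /negPf->.
rewrite (bigD1 (s i)) ?codom_f ?sa //= eqxx big1 ?addr0 // => b /andP[_].
by rewrite eq_sym => /negPf->.
Qed.

(** Let x, y be the indicators of spin [a] at [i] and [j]. If [a] is repeated, x y - (1 - x)(1 - y)
    = x + y - 1; otherwise x (1 - y) + y (1 - x) = x + y, since x and y are not both 1. *)
Lemma pair_sum_chi s a v i j :
    a \in codom s -> is_chi hN s a v -> i != j ->
  pair_sum hN i j s v = (stab_card s)%:R *
    ((s i == a)%:R + (s j == a)%:R - (1 < mult s a)%:R).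
Proof.
move=> sa [arr [Harr ->]] ij; rewrite chiE //.
have pE b c := pair_sum_pair_ket b c Harr ij.
have [a1|a_le1] := ltnP 1.
  rewrite pair_sumB pair_sum_sum pE.
  rewrite (eq_bigr (fun b => (stab_card s)%:R * ((s i == b)%:R * (s j != a)%:R))).
    rewrite -mulr_sumr -mulr_suml sum_codom_neq -mulrBr.
    by do 2!case: eqP => _ /=; ring.
  move=> b _; rewrite pair_sum_sum -(sum_codom_neq s a j) !mulr_sumr.
  by apply: eq_bigr => c _; rewrite pE.
rewrite pair_sum_sum.
rewrite (eq_bigr (fun b => (stab_card s)%:R * ((s i == a)%:R * (s j == b)%:R)
    + (stab_card s)%:R * ((s j == a)%:R * (s i == b)%:R))) => [|b _]; last first.
  by rewrite pair_sumD !pE; congr (_ + _ * _); rewrite mulrC.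
rewrite big_split /= -!mulr_sumr !sum_codom_neq subr0 -mulrDr; congr (_ * _).
have: ~~ ((s i == a) && (s j == a)).
  apply: contraTN a_le1 => /andP[/eqP si /eqP sj]; rewrite -ltnNge.
  by have := mult_pairs_gt0 s ij; rewrite si sj eqxx muln_gt0 subn_gt0 => /andP[].
by case: (s i == a); case: (s j == a) => //= _; ring.
Qed.

(** All kets with nonzero coefficient in chi lie in the orbit of [s]. *)
Lemma pair_sum_chi_off s a v t i j :
    a \in codom s -> is_chi hN s a v -> (forall rho, t != relabel s rho) ->
  pair_sum hN i j t v = 0.
Proof.
move=> sa [arr [Harr ->]] off; apply: big1 => pi _.
have pE b c : pair_ket arr s b c (relabel t pi) = 0.
  rewrite !ffunE; case: (posnP (mult s b * (mult s c - (b == c)))).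
    by move->; apply: scale0r.
  case/Harr=> -[pi0 ->] _ _.
  rewrite (_ : (relabel t pi == perm_config pi0 s) = false) ?[LHS]mulr0 //.
  apply/eqP => Dt.
  case/eqP: (off (pi^-1 * pi0^-1)%g).
  by rewrite -relabelM -(perm_configE pi0) -Dt relabelK.
rewrite chiE //; case: ifP => _.
  rewrite [LHS]ffunE pE add0r [LHS]ffunE sum_ffunE big1 ?oppr0 // => b _.
  by rewrite sum_ffunE big1.
by rewrite sum_ffunE big1 // => b _; rewrite [LHS]ffunE !pE addr0.
Qed.

End Chi.

(** * Orbit representatives and the spanning argument *)

Section Spanning.

Variables (K : numFieldType) (N twoM : nat) (hN : (2 < N)%N).
Implicit Types (s t u : config N twoM) (v w : state K N twoM).
Implicit Types (pi rho : 'S_N) (i j : 'I_N) (a b c : spin twoM).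

Local Notation p1 := (site1 hN).
Local Notation p2 := (site2 hN).

(** One label per orbit: [pick] depends only on the orbit as a set, and the default [t] is never
    reached. *)
Definition orbit_repr t : config N twoM :=
  odflt t [pick s | [exists rho, s == relabel t rho]].

Lemma orbit_reprP t : exists rho, orbit_repr t = relabel t rho.
Proof.
rewrite /orbit_repr; case: pickP => [s /existsP[rho /eqP->]|_]; first by exists rho.
by exists 1%g; rewrite relabel1.
Qed.

Lemma orbit_repr_relabel t rho : orbit_repr (relabel t rho) = orbit_repr t.
Proof.
rewrite /orbit_repr (eq_pick (Q := fun s => [exists rho', s == relabel t rho'])).
  case: pickP => // /(_ t)/existsP[]; exists 1%g.
  by rewrite relabel1.
move=> s; apply/existsP/existsP => -[rho' /eqP->].
  by exists (rho' * rho)%g; rewrite relabelM.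
by exists (rho' * rho^-1)%g; rewrite relabelM mulgKV.
Qed.

Lemma plus_stateD i j v w t :
  plus_state hN i j (v + w) t
  = (plus_state hN i j v t : K) + plus_state hN i j w t.
Proof. by rewrite !plus_stateE !pair_sumD; ring. Qed.

Lemma plus_stateZ i j k v t :
  plus_state hN i j (k *: v) t = k * (plus_state hN i j v t : K).
Proof. by rewrite !plus_stateE !pair_sumZ; ring. Qed.

Lemma plus_state_sum i j t I (r : seq I) (P : pred I) (F : I -> state K N twoM) :
  plus_state hN i j (\sum_(k <- r | P k) F k) t
  = \sum_(k <- r | P k) (plus_state hN i j (F k) t : K).
Proof.
rewrite plus_stateE !pair_sum_sum -big_split mulr_sumr /=.
by apply: eq_bigr => k _; rewrite plus_stateE.
Qed.

(** Both orders of a pair contribute the stabilizer order, hence the 2; N! is the normalization of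
    [plus_state]. *)
Definition chi_weight s : K := 2 * (stab_card s)%:R / N`!%:R.

Lemma chi_weight_neq0 s : chi_weight s != 0.
Proof.
rewrite /chi_weight !mulf_neq0 ?invr_eq0 ?pnatr_eq0 // -lt0n ?fact_gt0 //.
exact: stab_card_gt0.
Qed.

Lemma plus_state_chi s a v i j :
    a \in codom s -> is_chi hN s a v -> i != j ->
  plus_state hN i j v s = chi_weight s *
    ((s i == a)%:R + (s j == a)%:R - (1 < mult s a)%:R).
Proof.
move=> sa chi_v ij; rewrite plus_stateE !(pair_sum_chi sa chi_v) // 1?eq_sym //.
by rewrite /chi_weight; ring.
Qed.

Lemma plus_state_chi_off s a v t i j :
    a \in codom s -> is_chi hN s a v -> (forall rho, t != relabel s rho) ->
  plus_state hN i j v t = 0.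
Proof.
move=> sa chi_v off; rewrite plus_stateE !(pair_sum_chi_off _ _ sa chi_v off).
by rewrite addr0 mulr0.
Qed.

Lemma chi_in_Sigma' s a v :
  a \in codom s -> is_chi hN s a v -> in_Sigma' hN v.
Proof.
move=> sa chi_v; apply/in_Sigma'P => t.
have [/existsP[rho /eqP->]|] := boolP [exists rho, t == relabel s rho]; last first.
  move=> /existsPn off; exists (fun=> 0) => i j _.
  by rewrite (plus_state_chi_off _ _ sa chi_v off) addr0.
(* The constant is shared equally by the two sites. *)
exists (fun i => chi_weight s * ((s (rho i) == a)%:R - (1 < mult s a)%:R / 2)) => i j ij.
rewrite plus_state_relabel (plus_state_chi sa chi_v) ?(inj_eq perm_inj) //.
by field.
Qed.

(** If [i] and [i'] carry equal spins, a permutation fixing [t] and a third site [j] takes [i] to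
    [i']; so P(i, j) = P(i', j) and h(i) = h(i'). Such a [j] exists because N is at least 3. *)
Lemma spin_potential v t : in_Sigma' hN v ->
  exists eta : spin twoM -> K,
    forall i j, i != j -> plus_state hN i j v t = eta (t i) + eta (t j).
Proof.
move=> /in_Sigma'P/(_ t)[h Dh].
have h_const i i' : t i = t i' -> h i = h i'.
  move=> ti.
  have [j] : exists j, j \notin [set i; i'].
    apply/existsP; rewrite -negb_forall; apply: contraL hN => /forallP all_in.
    rewrite -leqNgt -[N]card_ord -cardsT.
    apply: (@leq_trans #|[set i; i']|); last by rewrite cards2 ltnS leq_b1.
    by apply/subset_leq_card/subsetP=> j _; apply: all_in.
  rewrite !inE negb_or => /andP[ji ji'].
  rewrite eq_sym in ji; rewrite eq_sym in ji'.
  have [rho [Dt Di Dj]] := exists_stab_pair ji ji' ti erefl.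
  have := plus_state_relabel hN i j v t rho.
  by rewrite Dt Di Dj !Dh // => /addIr.
exists (fun a => if [pick i | t i == a] is Some i then h i else 0) => i j ij.
rewrite Dh //; congr (_ + _); case: pickP => [k /eqP tk|/(_ _)].
- exact: h_const.
- by move/(_ i); rewrite eqxx.
- exact: h_const.
- by move/(_ j); rewrite eqxx.
Qed.

(** All terms equal [v t], and the number of permutations with two prescribed values, (N-2)!, is the
    same for every pair. *)
Lemma pair_sum_symmetric :
  exists2 m : nat, (0 < m)%N &
    forall v t i j, (forall u rho, v (relabel u rho) = v u) -> i != j ->
      pair_sum hN i j t v = m%:R * v t.
Proof.
exists #|[pred pi : 'S_N | (pi p1 == p1) && (pi p2 == p2)]|.
  by apply/card_gt0P; exists 1%g; rewrite inE /= !perm1 !eqxx.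
move=> v t i j symv ij.
have [rho [<- <-]] : exists rho : 'S_N, map rho [:: p1; p2] = [:: i; j].
  by apply: exists_perm_map; rewrite //= inE ij.
rewrite -pair_sum_relabel /pair_sum (eq_bigr (fun=> v t)) => [|pi _].
  by rewrite sumr_const mulr_natl.
by rewrite relabelM symv.
Qed.

Lemma Sigma'_spanned (X : config N twoM -> spin twoM -> state K N twoM) v :
    (forall s a, a \in codom s -> is_chi hN s a (X s a)) -> in_Sigma' hN v ->
  exists (sigma : state K N twoM) (c : config N twoM -> spin twoM -> K),
    symmetric_state sigma
    /\ equiv_state hN v
         (sigma + \sum_(s : config N twoM) \sum_(a in codom s) c s a *: X s a).
Proof.
move=> chiX v_in.
have [eta Deta] := fin_all_exists (fun t => spin_potential t v_in).
(* The total constant that the chi of repeated spins will subtract. *)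
pose e t := \sum_(a in codom t) eta t a * (1 < mult t a)%:R.
have [m m_gt0 Dm] := pair_sum_symmetric.
(* [sigma] restores these constants; its factor inverts 2 m / N!, the ratio of P to the coordinate
   of a symmetric state. *)
pose sigma : state K N twoM :=
  [ffun t => N`!%:R / (2 * m%:R) * e (orbit_repr t)].
have sym_sigma t rho : sigma (relabel t rho) = sigma t.
  by rewrite !ffunE orbit_repr_relabel.
(* Only one label per orbit gets coefficients, so that no orbit is counted repeatedly. *)
pose c s a := if s == orbit_repr s then eta s a / chi_weight s else 0.
exists sigma, c; split; first exact/symmetric_stateP.
apply: equiv_state_of_plus_state => t i j ij.
(* Relabelling the sites reduces [t] to its representative [r]. *)
have [rho Dr] := orbit_reprP t; rewrite -(relabelK t rho) -Dr.
have r_repr : orbit_repr (orbit_repr t) = orbit_repr t.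
  by rewrite {1}Dr orbit_repr_relabel.
move: (orbit_repr t) r_repr => r r_repr {t Dr}; rewrite !plus_state_relabel.
rewrite -(inj_eq (@perm_inj _ rho^-1)) in ij.
move: (rho^-1 i)%g (rho^-1 j)%g ij => {}i {}j ij {rho}.
(* Any other [s] has zero coefficients or lies in another orbit. *)
rewrite plus_stateD plus_state_sum (bigD1 r) //= [X in _ + (_ + X)]big1 => [|s sr].
  rewrite addr0 Deta // plus_stateE !(Dm sigma) // 1?eq_sym // [sigma r]ffunE r_repr //.
  rewrite plus_state_sum (eq_bigr (fun a => eta r a * (r i == a)%:R
     + eta r a * (r j == a)%:R - eta r a * (1 < mult r a)%:R)); last first.
    move=> a ra; rewrite plus_stateZ (plus_state_chi ra (chiX r a ra)) //.
    rewrite /c r_repr eqxx; have := chi_weight_neq0 r; set k := chi_weight r => k0.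
    by field.
  have etaE k : \sum_(a in codom r) eta r a * (r k == a)%:R = eta r (r k).
    rewrite (bigD1 (r k)) ?codom_f //= eqxx mulr1 big1 ?addr0 // => a /andP[_].
    by rewrite eq_sym => /negPf->; rewrite mulr0.
  rewrite sumrB big_split /= !etaE -/(e r).
  have Nf : N`!%:R != 0 :> K by rewrite pnatr_eq0 -lt0n fact_gt0.
  have mf : m%:R != 0 :> K by rewrite pnatr_eq0 -lt0n.
  by field; rewrite Nf mf.
rewrite plus_state_sum big1 // => a sa; rewrite plus_stateZ /c.
case: eqP => [Ds|_]; last exact: mul0r.
rewrite (plus_state_chi_off _ _ sa (chiX s a sa)) ?mulr0 // => rho.
by apply: contraNneq sr => Dr; rewrite -r_repr Dr orbit_repr_relabel -Ds.
Qed.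

End Spanning.

(** [X] is an arbitrary choice of the orderings hidden in the chi. The first conjunct places these
    states in Sigma', so that they have classes in the quotient. *)
Theorem proposition4 (R : realType) (N twoM : nat) (hN : (2 < N)%N)
    (X : config N twoM -> spin twoM -> state R[i] N twoM)
    (hX : forall (s : config N twoM) (a : spin twoM),
       a \in codom s -> is_chi hN s a (X s a)) :
  (forall (s : config N twoM) (a : spin twoM),
     a \in codom s -> in_Sigma' hN (X s a))
  /\
  (forall v : state R[i] N twoM, in_Sigma' hN v ->
     exists (sigma : state R[i] N twoM)
            (c : config N twoM -> spin twoM -> R[i]),
       symmetric_state sigma
       /\ equiv_state hN v
            (sigma + \sum_(s : config N twoM) \sum_(a in codom s)
                       c s a *: X s a)).
Proof.
split=> [s a sa | v v_in]; first exact: chi_in_Sigma' (hX s a sa).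
exact: Sigma'_spanned.
Qed.
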